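(* Let $(X,d)$ be a complete metric space, let $\eta\in\mathbb{N}$, and let $\mathcal{U}:\prod_{i=1}^{\infty}X\to X$ be a Banach's generalized contraction for infinite dimensions, or a Kannan's generalized contraction for infinite dimensions, or a Fisher's generalized contraction for infinite dimensions. Then $\mathcal{U}$ has a unique fixed point, i.e. there is a unique $w\in X$ with $\mathcal{U}(w,w,w,\ldots)=w$.
   Context: For points $w_1,\ldots,w_\eta\in X$, write $(w_{i,\widehat{\eta}})_{i=1}^{\infty}=(w_1,w_2,\ldots,w_{\eta-1},w_\eta,w_\eta,w_\eta,\ldots)$ for the infinite tuple in which the $\eta$-th point is repeated forever. For infinite tuples $\mathbf{w}=(w_i)_{i=1}^\infty$, $\mathbf{v}=(v_i)_{i=1}^\infty$ in $X$, put $B_\eta(\mathbf{w},\mathbf{v})=d(w_\eta,v_\eta)$, $K_\eta(\mathbf{w},\mathbf{v})=d(\mathcal{U}(\mathbf{w}),w_\eta)+d(\mathcal{U}(\mathbf{v}),v_\eta)$ and $F_\eta(\mathbf{w},\mathbf{v})=d(\mathcal{U}(\mathbf{w}),v_\eta)+d(\mathcal{U}(\mathbf{v}),w_\eta)$. $\mathcal{U}$ is a Banach's (respectively Kannan's, respectively Fisher's) generalized contraction for infinite dimensions if there is a fixed $c\in(0,1/2)$ such that for all $w_1,\ldots,w_\eta,v_1,\ldots,v_\eta\in X$, with $\mathbf{w}=(w_{i,\widehat{\eta}})_{i=1}^\infty$ and $\mathbf{v}=(v_{i,\widehat{\eta}})_{i=1}^\infty$, one has $d(\mathcal{U}(\mathbf{w}),\mathcal{U}(\mathbf{v}))\le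 c\,B_\eta(\mathbf{w},\mathbf{v})$ (respectively $d(\mathcal{U}(\mathbf{w}),\mathcal{U}(\mathbf{v}))\le c\,K_\eta(\mathbf{w},\mathbf{v})$, respectively $d(\mathcal{U}(\mathbf{w}),\mathcal{U}(\mathbf{v}))\le c\,F_\eta(\mathbf{w},\mathbf{v})$). *)

(* Defs.v *)
From HB Require Import structures.
From mathcomp Require Import all_boot all_order all_algebra.
From mathcomp Require Import all_classical all_reals all_analysis.

Set Implicit Arguments.
Unset Strict Implicit.
Unset Printing Implicit Defensive.

Import Order.TTheory GRing.Theory Num.Theory.

Local Open Scope ring_scope.

(* [Complete] includes [isPointed]: a complete metric space is nonempty here,
   without which no fixed-point theorem could hold. *)
#[short(type="completeMetricType")]
HB.structure Definition CompleteMetric (R : numDomainType) :=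
  {X of Complete X & Metric R X}.

(* Infinite tuples are functions [nat -> X] indexed from 0, and the positive
   integer eta is [n.+1]; hence the eta-th entry of [w] is [w n]. *)

(* (w_1, ..., w_eta, w_eta, w_eta, ...) *)
Definition repeat_last (X : Type) (n : nat) (w : 'I_n.+1 -> X) : nat -> X :=
  fun i => w (inord (minn i n)).

Definition banach_term (R : realType) (X : metricType R) (n : nat)
    (w v : nat -> X) : R :=
  mdist (w n) (v n).

Definition kannan_term (R : realType) (X : metricType R)
    (U : (nat -> X) -> X) (n : nat) (w v : nat -> X) : R :=
  mdist (U w) (w n) + mdist (U v) (v n).

Definition fisher_term (R : realType) (X : metricType R)
    (U : (nat -> X) -> X) (n : nat) (w v : nat -> X) : R :=
  mdist (U w) (v n) + mdist (U v) (w n).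

Definition contraction_wrt (R : realType) (X : metricType R)
    (U : (nat -> X) -> X) (n : nat) (E : (nat -> X) -> (nat -> X) -> R) : Prop :=
  exists2 c : R, 0 < c < 1 / 2 &
    forall w v : 'I_n.+1 -> X,
      mdist (U (repeat_last w)) (U (repeat_last v))
        <= c * E (repeat_last w) (repeat_last v).

Definition banach_contraction (R : realType) (X : metricType R) (n : nat)
    (U : (nat -> X) -> X) : Prop :=
  contraction_wrt U n (banach_term n).

Definition kannan_contraction (R : realType) (X : metricType R) (n : nat)
    (U : (nat -> X) -> X) : Prop :=
  contraction_wrt U n (kannan_term U n).

Definition fisher_contraction (R : realType) (X : metricType R) (n : nat)
    (U : (nat -> X) -> X) : Prop :=
  contraction_wrt U n (fisher_term U n).

(* Main.v *)
(** Restricted to constant tuples, each of the three conditions says something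
    about [f x := U (x, x, ...)], and with [k := c / (1 - c) < 1] each implies
    [d(f x, f y) <= k d(x, y) + 2 k d(x, f x)] and
    [d(f x, f (f x)) <= k d(x, f x)]. By the second inequality the Picard
    iterates of [f] form a Cauchy sequence; by the first one their limit is
    fixed and fixed points are unique. *)

Require Import Defs.
From mathcomp Require Import all_boot all_order all_algebra.
From mathcomp Require Import all_classical all_reals all_analysis.
From mathcomp Require Import lra.

Set Implicit Arguments.
Unset Strict Implicit.
Unset Printing Implicit Defensive.

Import Order.TTheory GRing.Theory Num.Theory.
Import numFieldNormedType.Exports.

Local Open Scope classical_set_scope.
Local Open Scope ring_scope.

(** The triangle inequality sums the steps, and the sum telescopes because
    [(1 - q) * q ^+ k = q ^+ k - q ^+ k.+1]; the factor [1 - q] on the left avoids division. *)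
Lemma mdist_geometric_tail (R : realType) (X : metricType R) (u : nat -> X)
    (C q : R) :
  (forall k, mdist (u k) (u k.+1) <= C * q ^+ k) -> q < 1 ->
  forall n m, (1 - q) * mdist (u n) (u (n + m)%N) <= C * (q ^+ n - q ^+ (n + m)).
Proof.
move=> hu q1 n; elim=> [|m ih]; first by rewrite addn0 mdistxx subrr !mulr0.
have htri := metric_triangle (u n) (u (n + m)%N) (u (n + m.+1)%N).
have := hu (n + m)%N; rewrite -addnS => hstep.
have q1' : 0 <= 1 - q by lra.
have := ler_wpM2l q1' (le_trans htri (lerD (lexx _) hstep)).
rewrite addnS exprS; lra.
Qed.

Lemma cvgn_geometric_steps (R : realType) (X : completeMetricType R)
    (u : nat -> X) (C q : R) :
  (forall k, mdist (u k) (u k.+1) <= C * q ^+ k) -> 0 <= q < 1 -> cvgn u.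
Proof.
move=> hu /andP[q0 q1]; apply: cauchy_cvg; apply/cauchy_exP => e e0.
have C0 : 0 <= C.
  by have := le_trans (mdist_ge0 _ _) (hu 0%N); rewrite expr0 mulr1.
have q1' : 0 < 1 - q by lra.
have geo : (C * q ^+ n) @[n --> \oo] --> (0 : R).
  by apply: cvg_geometric; rewrite ger0_norm.
have e1 : 0 < (1 - q) * e by rewrite mulr_gt0.
(* With [C * q ^+ N < (1 - q) * e], the tail bound puts all later terms in the ball of radius [e]
   around [u N]. *)
have /cvgrPdist_lt/(_ _ e1)[N _ hN] := geo.
exists (u N), N => //= m Nm.
rewrite ballEmdist /= -(ltr_pM2l q1').
have := mdist_geometric_tail hu q1 N (m - N); rewrite subnKC // => hm.
apply: (le_lt_trans hm).
have := hN N (leqnn _); rewrite /= sub0r normrN ger0_norm; last first.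
  by rewrite mulr_ge0 // exprn_ge0.
by apply: le_lt_trans; rewrite ler_wpM2l // gerBl exprn_ge0.
Qed.

(* The first inequality is Berinde's "weak contraction" condition. *)
Lemma weak_contraction_fixpoint (R : realType) (X : completeMetricType R)
    (f : X -> X) (k L : R) :
  0 <= k < 1 -> 0 <= L ->
  (forall x y, mdist (f x) (f y) <= k * mdist x y + L * mdist x (f x)) ->
  (forall x, mdist (f x) (f (f x)) <= k * mdist x (f x)) ->
  exists! x, f x = x.
Proof.
move=> /andP[k0 k1] L0 hf hs.
pose u n := iter n f (point : X).
have hu n : mdist (u n) (u n.+1) <= mdist (u 0%N) (u 1%N) * k ^+ n.
  elim: n => [|n ih]; first by rewrite expr0 mulr1.
  by apply: (le_trans (hs _)); rewrite exprS mulrCA ler_wpM2l.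
have /cvg_ex[l ul] : cvgn u.
  by apply: cvgn_geometric_steps hu _; rewrite k0.
have fl : f l = l.
  apply: mdist_positivity; apply/eqP; rewrite eq_le mdist_ge0 andbT.
  apply/ler_addgt0Pr => e e0; rewrite add0r.
  (* If [u N] and [u N.+1] are within [d] of [l], then going through [u N.+1 = f (u N)] gives
     [mdist (f l) l <= (1 + k + 2 * L) * d < e]. *)
  have d0 : 0 < e / (2 + k + L * 2) by rewrite divr_gt0 //; lra.
  have [N _ hN] := (metricType_numDomainType.cvgrPdist_lt _ _).1 ul _ d0.
  have hN0 := hN N (leqnn _); have hN1 := hN N.+1 (leqnSn _).
  have := hf (u N) l; rewrite -[f (u N)]/(u N.+1) => hfl.
  have t1 := metric_triangle (f l) (u N.+1) l.
  have t2 := metric_triangle (u N) l (u N.+1).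
  rewrite /= in hN0 hN1.
  set d := e / _ in d0 hN0 hN1.
  have -> : e = d * (2 + k + L * 2) by rewrite divfK // gt_eqF //; lra.
  rewrite (metric_sym (f l) (u N.+1)) (metric_sym (u N.+1) l) in t1.
  rewrite (metric_sym (u N) l) in t2 hfl.
  have a1 := ler_wpM2l k0 (ltW hN0).
  have a2 := ler_wpM2l L0 (le_trans t2 (ltW (ltrD hN0 hN1))).
  lra.
exists l; split=> // y fy; apply: mdist_positivity.
(* The [L] term vanishes at the fixed point [l], leaving [mdist l y <= k * mdist l y]. *)
have := hf l y; rewrite fl fy mdistxx mulr0 addr0 => h.
apply/eqP; rewrite eq_le mdist_ge0 andbT -(@pmulr_rle0 _ (1 - k)); lra.
Qed.

Theorem corollary2p32 (R : realType) (X : completeMetricType R) (n : nat)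
    (U : (nat -> X) -> X)
    (hU : banach_contraction n U \/ kannan_contraction n U
          \/ fisher_contraction n U) :
  exists! w : X, U (fun _ => w) = w.
Proof.
pose f x := U (fun _ => x).
have [c /andP[c0 c2] hc] : exists2 c : R, 0 < c < 1 / 2 &
    (forall x y, mdist (f x) (f y) <= c * mdist x y) \/
    (forall x y, mdist (f x) (f y) <= c * (mdist (f x) x + mdist (f y) y)) \/
    (forall x y, mdist (f x) (f y) <= c * (mdist (f x) y + mdist (f y) x)).
  (* [repeat_last] of a constant tuple is convertible to the constant sequence. *)
  case: hU => [|[|]] [c hc h]; exists c => //; [left|right; left|right; right];
    by move=> x y; exact: (h (fun=> x) (fun=> y)).
have c1 : 0 < 1 - c by lra.
pose k := c / (1 - c).
have ck : c = k * (1 - c) by rewrite divfK // gt_eqF.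
have k0 : 0 < k by rewrite divr_gt0.
(* This is where [c < 1 / 2] is used. *)
have k1 : k < 1 by rewrite ltr_pdivrMr //; lra.
have leP a b : (1 - c) * a <= c * b -> a <= k * b.
  by rewrite {2}ck mulrAC [leRHS]mulrC ler_pM2l.
apply: (@weak_contraction_fixpoint _ _ f k (k * 2)); first by rewrite ltW.
- by rewrite mulr_ge0 // ltW.
- move=> x y; rewrite -mulrA -mulrDr; apply: leP.
  have D0 := mdist_ge0 (f x) (f y); have d0 := mdist_ge0 x (f x).
  have cD0 := mulr_ge0 (ltW c0) D0; have cd0 := mulr_ge0 (ltW c0) d0.
  (* Kannan's bound uses [t3] then [t1], Fisher's [t1] and [t2]; both give [c * (mdist (f x) (f y) +
     mdist x y + 2 * mdist x (f x))], whose first term is absorbed on the left. *)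
  have t1 := metric_triangle (f x) x y.
  have t2 := metric_triangle (f y) (f x) x.
  have t3 := metric_triangle (f y) (f x) y.
  rewrite !(metric_sym (f y) (f x)) !(metric_sym (f x) x) in t1 t2 t3.
  have b1 := ler_wpM2l (ltW c0) t1; have b2 := ler_wpM2l (ltW c0) t2.
  have b3 := ler_wpM2l (ltW c0) t3.
  case: hc => [|[|]] /(_ x y); rewrite ?(metric_sym (f x) x); lra.
- move=> x; apply: leP.
  have D0 := mdist_ge0 (f x) (f (f x)).
  have cD0 := mulr_ge0 (ltW c0) D0.
  (* Only Fisher's case needs [t]: there the bound is [c * mdist x (f (f x))]. *)
  have t := metric_triangle x (f x) (f (f x)).
  have b := ler_wpM2l (ltW c0) t.
  case: hc => [|[|]] /(_ x (f x));
    rewrite ?mdistxx ?(metric_sym (f x) x) ?(metric_sym (f (f x))); lra.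
Qed.
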